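(* Let $\alpha=(\alpha_n)_{n\in\mathbb{N}}$ be any sequence with $\alpha_n\uparrow\infty$. The Cesàro operator $\mathsf{C}\in\mathcal{L}(\Lambda_0(\alpha))$ is power bounded and uniformly mean ergodic. In particular, $$\Lambda_0(\alpha)=\operatorname{Ker}(I-\mathsf{C})\oplus\overline{(I-\mathsf{C})(\Lambda_0(\alpha))}.$$ Moreover, it is also the case that $\operatorname{Ker}(I-\mathsf{C})=\operatorname{span}\{\mathbf{1}\}$ and $$\overline{(I-\mathsf{C})(\Lambda_0(\alpha))}=\{x\in\Lambda_0(\alpha)\colon x_1=0\}=\overline{\operatorname{span}\{e_n\}_{n\geq2}},$$ where $\mathbf{1}:=(1)_{n\in\mathbb{N}}$ is the constant sequence, $e_n$ is the $n$-th canonical unit vector, and closures are taken in $\Lambda_0(\alpha)$.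
   Context: Notation: $\mathbb{N}=\{1,2,3,\ldots\}$. The notation $\alpha_n\uparrow\infty$ means that $\alpha=(\alpha_n)_{n\in\mathbb{N}}\subseteq(1,\infty)$ satisfies $\alpha_n<\alpha_{n+1}$ for all $n\in\mathbb{N}$ and $\lim_{n\to\infty}\alpha_n=\infty$. For $k,n\in\mathbb{N}$ put $w_k(n):=e^{-\alpha_n/k}$. The power series space of finite type is $\Lambda_0(\alpha):=\{x\in\mathbb{C}^{\mathbb{N}}\colon \lim_{n\to\infty}w_k(n)|x_n|=0 \text{ for all } k\in\mathbb{N}\}$, a Fréchet space for the topology generated by the increasing sequence of norms $p_k(x):=\sup_{n\in\mathbb{N}}w_k(n)|x_n|$, $k\in\mathbb{N}$. The discrete Cesàro operator is $\mathsf{C}x:=\left(x_1,\frac{x_1+x_2}{2},\ldots,\frac{x_1+\cdots+x_n}{n},\ldots\right)$ for $x\in\mathbb{C}^{\mathbb{N}}$; it maps $\Lambda_0(\alpha)$ continuously into itself. For a Fréchet space $X$, $\mathcal{L}(X)$ is the space of continuous linear operators from $X$ into itself and $\mathcal{L}_b(X)$ is $\mathcal{L}(X)$ with the topology of uniform convergence on bounded subsets of $X$. $T\in\mathcal{L}(X)$ is power bounded if $\{T^n\}_{n=1}^\infty$ is an equicontinuous subset of $\mathcal{L}(X)$; it is uniformly mean ergodic if the sequence of Cesàro means $T_{[n]}:=\frac1n\sum_{m=1}^nT^m$, $n\in\mathbb{N}$, converges in $\mathcal{L}_b(X)$. *)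

(* Defs.v *)
From HB Require Import structures.
From mathcomp Require Import all_boot all_order all_algebra.
From mathcomp Require Import all_classical all_reals all_analysis.
From mathcomp Require Import complex.

Set Implicit Arguments.
Unset Strict Implicit.
Unset Printing Implicit Defensive.

Import Order.TTheory GRing.Theory Num.Theory.
Import numFieldNormedType.Exports.
Import Normc.

Local Open Scope classical_set_scope.
Local Open Scope ring_scope.
Local Open Scope complex_scope.

(* $\mathcal L(X)$. *)
Record contLinear (K : numDomainType) (X : tvsType K) := ContLinear {
  contLinear_fun :> {linear X -> X};
  contLinear_cont : continuous contLinear_fun }.

Section Generic.
Variables (K : numFieldType) (X : tvsType K).

(* Von Neumann boundedness: [B] is absorbed by every neighborhood of 0. For
   [K] a field of complex numbers, [0 < r] says that [r] is real and positive. *)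
Definition tvs_bounded (B : set X) :=
  forall U : set X, nbhs 0 U ->
    exists2 r : K, 0 < r & B `<=` [set r *: u | u in U].

(* The Cesaro means $T_{[n]}$ for [n >= 1]; the value at [n = 0] is junk and
   does not affect the limit below. *)
Definition cesaro_mean (T : X -> X) (n : nat) : X -> X :=
  fun x => n%:R^-1 *: \sum_(1 <= m < n.+1) iter m T x.

(* Convergence in $\mathcal L_b(X)$: [{family tvs_bounded, _ --> _}] is uniform
   convergence on bounded sets, and the limit is a continuous linear operator. *)
Definition uniformly_mean_ergodic (T : contLinear X) :=
  exists P : contLinear X,
    {family tvs_bounded, cesaro_mean T n @[n --> \oo] --> (P : X -> X)}.

Definition linear_span (A : set X) : set X :=
  [set x | exists n (v : 'I_n -> X) (c : 'I_n -> K),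
     (forall i, A (v i)) /\ x = \sum_i c i *: v i].

(* Algebraic direct sum decomposition, for linear subspaces [A] and [B]. *)
Definition direct_sum (A B : set X) :=
  (forall x, exists a b, [/\ A a, B b & x = a + b]) /\ A `&` B = [set 0].

End Generic.

Definition power_bounded (X : puniformType) (T : X -> X) :=
  equicontinuous [set n | (0 < n)%N] (fun n => iter n T).

Definition increases_to_infty (R : realType) (alpha : nat -> R) :=
  [/\ forall n, 1 < alpha n, forall n, alpha n < alpha n.+1
    & alpha n @[n --> \oo] --> +oo].

Section Lambda0.
Variables (R : realType) (alpha : nat -> R).

(* Sequences are indexed from 0: [alpha n] is $\alpha_{n+1}$ and
   [weight k n] is $w_{k+1}(n+1)$. *)
Definition weight (k n : nat) : R := expR (- (alpha n / k.+1%:R)).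

Definition lambda0_pred : {pred nat -> R[i]} :=
  fun x => `[< forall k, weight k n * normc (x n) @[n --> \oo] --> 0 >].

Lemma lambda0P x : reflect (forall k, weight k n * normc (x n) @[n --> \oo] --> 0)
  (x \in lambda0_pred).
Proof. exact: asboolP. Qed.

Lemma weight_gt0 k n : 0 < weight k n. Proof. exact: expR_gt0. Qed.

Lemma weight_ge0 k n : 0 <= weight k n. Proof. exact: expR_ge0. Qed.

Lemma normc_ge0 (z : R[i]) : 0 <= normc z.
Proof. by case: z => a b; exact: sqrtr_ge0. Qed.

Lemma lambda0_submod : submod_closed lambda0_pred.
Proof.
split.
  apply/lambda0P => k; rewrite [X in X @ _ --> _](_ : _ = cst 0); first exact: cvg_cst.
  by apply/funext => n; exact: etrans (congr1 _ (normc0 R)) (mulr0 _).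
move=> a x y /lambda0P xL /lambda0P yL; apply/lambda0P => k.
apply: (@squeeze_cvgr _ _ _ _ (cst 0)
  (fun n => normc a * (weight k n * normc (x n)) + weight k n * normc (y n))).
- near=> n; rewrite mulr_ge0 ?weight_ge0 ?normc_ge0//=.
  rewrite mulrCA -normcM -mulrDr ler_wpM2l ?weight_ge0//.
  exact: le_normcD.
- exact: cvg_cst.
- rewrite -[X in _ --> X]addr0; apply: cvgD; last exact: yL.
  by rewrite -(mulr0 (normc a)); apply: cvgMr; exact: xL.
Unshelve. all: by end_near. Qed.

HB.instance Definition _ :=
  GRing.isSubmodClosed.Build R[i] (nat -> R[i]) lambda0_pred lambda0_submod.

Record lambda0 := Lambda0 {
  lambda0_fun :> nat -> R[i];
  lambda0_mem : lambda0_fun \in lambda0_pred }.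

HB.instance Definition _ := [isSub for lambda0_fun].
HB.instance Definition _ := [Choice of lambda0 by <:].
HB.instance Definition _ := [SubChoice_isSubLmodule of lambda0 by <:].
HB.instance Definition _ := isPointed.Build lambda0 0.

Definition pnorm (k : nat) (x : lambda0) : R :=
  sup (range (fun n => weight k n * normc (x n))).

Lemma pnorm_has_sup k (x : lambda0) : has_sup (range (fun n => weight k n * normc (x n))).
Proof.
split; first by exists (weight k 0 * normc (x 0%N)), 0%N.
have /lambda0P/(_ k)/cvgP/cvg_seq_bounded := lambda0_mem x.
move=> [M [_ /(_ (M + 1))]]; rewrite ltrDl ltr01 => /(_ isT) xM.
by exists (M + 1) => _ [n _ <-]; rewrite (le_trans (ler_norm _))// xM.
Qed.

Lemma le_pnorm k (x : lambda0) n : weight k n * normc (x n) <= pnorm k x.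
Proof. by apply: ub_le_sup; [exact: (pnorm_has_sup k x).2|exists n]. Qed.

Lemma pnorm_le k (x : lambda0) M : (forall n, weight k n * normc (x n) <= M) -> pnorm k x <= M.
Proof.
move=> xM; apply: ge_sup; first exact: (pnorm_has_sup k x).1.
by move=> _ [n _ <-].
Qed.

Lemma pnorm_ge0 k x : 0 <= pnorm k x.
Proof. by rewrite (le_trans _ (le_pnorm k x 0%N))// mulr_ge0 ?weight_ge0 ?normc_ge0. Qed.

Lemma pnorm0 k : pnorm k 0 = 0.
Proof.
apply/eqP; rewrite eq_le pnorm_ge0 andbT; apply: pnorm_le => n.
by rewrite [leLHS](_ : _ = 0)//; exact: etrans (congr1 _ (normc0 R)) (mulr0 _).
Qed.

Lemma pnorm_triangle k x y : pnorm k (x + y) <= pnorm k x + pnorm k y.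
Proof.
apply: pnorm_le => n; rewrite (le_trans _ (lerD (le_pnorm k x n) (le_pnorm k y n)))//.
by rewrite -mulrDr ler_wpM2l ?weight_ge0//; exact: le_normcD.
Qed.

Lemma pnorm_scale_le k a x : pnorm k (a *: x) <= normc a * pnorm k x.
Proof.
apply: pnorm_le => n; have -> : (a *: x) n = a * x n by [].
rewrite normcM mulrCA.
by rewrite ler_wpM2l ?normc_ge0 ?le_pnorm.
Qed.

Lemma pnormN k x : pnorm k (- x) = pnorm k x.
Proof.
have le y : pnorm k (- y) <= pnorm k y by apply: pnorm_le => n /=; rewrite normcN le_pnorm.
by apply/eqP; rewrite eq_le le -{1}[x]opprK le.
Qed.

Local Open Scope convex_scope.
(* The uniformity of the locally convex topology generated by the seminorms
   [pnorm k]. The bound ranges over all [j <= k] so that no monotonicity of the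
   [pnorm k] (i.e. [alpha >= 0]) is needed for this to be a filter. *)
Definition lambda0_ent : set_system (lambda0 * lambda0) :=
  [set A | exists k e, 0 < e /\
     forall x y, (forall j, (j <= k)%N -> pnorm j (x - y) < e) -> A (x, y)].

Lemma lambda0_ent_filter : Filter lambda0_ent.
Proof.
split; first by exists 0%N, 1; split.
- move=> A B [k [e [e0 kA]]] [l [d [d0 lB]]].
  exists (maxn k l), (Num.min e d); split; first by rewrite lt_min e0.
  move=> x y xy; split; [apply: kA|apply: lB] => j jk;
    have /xy : (j <= maxn k l)%N by rewrite leq_max jk ?orbT.
  + by rewrite lt_min => /andP[].
  + by rewrite lt_min => /andP[].
- by move=> A B AB [k [e [e0 kA]]]; exists k, e; split=> // x y /kA/AB.
Qed.

Lemma lambda0_ent_refl A : lambda0_ent A -> diagonal `<=` A.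
Proof.
move=> [k [e [e0 kA]]] [x y] /= xy; have {xy}-> : x = y := xy; apply: kA => j _.
by rewrite subrr pnorm0.
Qed.

Lemma lambda0_ent_inv A : lambda0_ent A -> lambda0_ent A^-1%relation.
Proof.
move=> [k [e [e0 kA]]]; exists k, e; split=> // x y xy; apply: kA => j jk.
by rewrite -opprB pnormN xy.
Qed.

Lemma lambda0_ent_split A : lambda0_ent A ->
  exists2 B, lambda0_ent B & (B \; B)%relation `<=` A.
Proof.
move=> [k [e [e0 kA]]].
exists [set xy | forall j, (j <= k)%N -> pnorm j (xy.1 - xy.2) < e / 2].
  by exists k, (e / 2); split; [rewrite divr_gt0|].
move=> [x y] [z /= xz zy]; apply: kA => j jk.
rewrite -(subrK z x) -addrA (le_lt_trans (pnorm_triangle _ _ _))//.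
by rewrite [e]splitr ltrD ?xz ?zy.
Qed.

HB.instance Definition _ := isUniform.Build lambda0
  lambda0_ent_filter lambda0_ent_refl lambda0_ent_inv lambda0_ent_split.

Lemma lambda0_nbhsP (x : lambda0) (A : set lambda0) : nbhs x A <->
  exists k e, 0 < e /\ forall y, (forall j, (j <= k)%N -> pnorm j (x - y) < e) -> A y.
Proof.
rewrite -nbhs_entourageE; split.
  move=> [B [k [e [e0 kB]]] BA]; exists k, e; split=> // y xy.
  by apply/BA/xsectionP/kB.
move=> [k [e [e0 kA]]].
exists [set xy | forall j, (j <= k)%N -> pnorm j (xy.1 - xy.2) < e].
  by exists k, e; split.
by move=> y /xsectionP; exact: kA.
Qed.

Lemma lambda0_add_continuous : continuous (fun z : lambda0 * lambda0 => z.1 + z.2).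
Proof.
move=> [x y] U /lambda0_nbhsP[k [e [e0 kU]]].
pose V z := [set t | forall j, (j <= k)%N -> pnorm j (z - t) < e / 2].
exists (V x, V y).
  by split; apply/lambda0_nbhsP; exists k, (e / 2); split; rewrite ?divr_gt0.
move=> [u v]/= [xu yv]; apply: kU => j jk.
rewrite opprD addrACA (le_lt_trans (pnorm_triangle _ _ _))//.
by rewrite [e]splitr ltrD ?xu ?yv.
Qed.

Lemma lambda0_scale_continuous :
  continuous (fun z : R[i]^o * lambda0 => z.1 *: z.2).
Proof.
move=> [a x] U /lambda0_nbhsP[k [e [e0 kU]]].
pose M := 1 + normc a + \sum_(j < k.+1) pnorm j x.
have M1 : 1 <= M.
  by rewrite /M -addrA lerDl addr_ge0 ?normc_ge0// sumr_ge0// => j _; exact: pnorm_ge0.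
have M0 : 0 < M by rewrite (lt_le_trans _ M1).
have pM j : (j <= k)%N -> pnorm j x <= M.
  rewrite -ltnS => jk; rewrite /M (bigD1 (Ordinal jk))//= addrCA lerDl.
  by rewrite addr_ge0 ?addr_ge0 ?normc_ge0// sumr_ge0// => i _; exact: pnorm_ge0.
pose d := Num.min 1 (e / 2 / M).
have d0 : 0 < d by rewrite lt_min ltr01 !divr_gt0.
exists ([set b | normc (a - b) < d],
        [set t | forall j, (j <= k)%N -> pnorm j (x - t) < d]).
  split; last by apply/lambda0_nbhsP; exists k, d.
  apply/nbhs_ballP; exists d%:C; first by rewrite /= ltcR.
  by move=> b; rewrite -ball_normE /= normc_def ltcR; case: (a - b).
move=> [b t]/= [ab xt]; apply: kU => j jk.
have -> : a *: x - b *: t = (a - b) *: x + b *: (x - t).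
  by rewrite scalerBl scalerBr addrA subrK.
rewrite (le_lt_trans (pnorm_triangle _ _ _))// [e]splitr ltr_leD//.
  rewrite (le_lt_trans (pnorm_scale_le _ _ _))//.
  rewrite (@le_lt_trans _ _ (normc (a - b) * M)) ?ler_wpM2l ?normc_ge0 ?pM//.
  by rewrite -ltr_pdivlMr// (lt_le_trans ab)// ge_min lexx orbT.
rewrite (le_trans (pnorm_scale_le _ _ _))//.
have bM : normc b <= M.
  rewrite -(subrK a b) (le_trans (le_normcD _ _))//.
  rewrite -opprB normcN /M -addrA lerD//.
    by rewrite (le_trans (ltW ab))// ge_min lexx.
  by rewrite lerDl sumr_ge0// => i _; exact: pnorm_ge0.
rewrite (@le_trans _ _ (M * (e / 2 / M)))//; last by rewrite mulrC divfK// gt_eqF.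
rewrite ler_pM ?normc_ge0 ?pnorm_ge0//.
by rewrite (le_trans (ltW (xt _ jk)))// ge_min lexx orbT.
Qed.

Lemma lambda0_locally_convex : exists2 B : set_system lambda0,
  (forall b, b \in B -> convex_set b) & basis B.
Proof.
exists [set b | exists x k e,
    b = [set y : lambda0 | forall j, (j <= k)%N -> pnorm j (x - y) < e]].
  move=> b /[!inE] -[x [k [e ->]]]; apply/convex_setW => y z /[!inE]/= xy xz l l0 l1.
  rewrite inE /= => j jk.
  move: l0 l1; rewrite !ltcE /= => /andP[/eqP Iml l0] /andP[_ l1].
  set t := complex.Re l%:num in l0 l1.
  have lE : l%:num = t%:C by move: Iml; rewrite /t; case: (l%:num) => ? ? /= ->.
  have -> : x - ((y : convex_lmodType lambda0) <| l |> z)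
      = t%:C *: (x - y) + (1 - t)%:C *: (x - z).
    rewrite [_ <| _ |> _](_ : _ = t%:C *: y + (1 - t)%:C *: z); last first.
      by rewrite -lE rmorphB /= -lE.
    rewrite !scalerBr addrACA -scalerDl -rmorphD/= [t + _]addrC subrK scale1r.
    by rewrite opprD.
  have normt (u : R) : 0 < u -> normc u%:C = u.
    by move=> u0; rewrite /= expr0n addr0 sqrtr_sqr gtr0_norm.
  rewrite (le_lt_trans (pnorm_triangle _ _ _))//.
  rewrite (le_lt_trans (lerD (pnorm_scale_le _ _ _) (pnorm_scale_le _ _ _)))//.
  rewrite !normt ?subr_gt0//.
  have -> : e = t * e + (1 - t) * e by rewrite -mulrDl addrC subrK mul1r.
  by rewrite ltrD// ltr_pM2l ?subr_gt0// ?xy ?xz.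
split.
  move=> _ [x [k [e ->]]]; rewrite openE => y /= xy.
  pose d := \big[Num.min/1]_(j < k.+1) (e - pnorm j (x - y)).
  have d0 : 0 < d.
    by apply/lt_bigmin => // j _; rewrite subr_gt0 xy// -ltnS.
  apply/lambda0_nbhsP; exists k, d; split=> // z yz j jk.
  rewrite -(subrK y x) -addrA (le_lt_trans (pnorm_triangle _ _ _))//.
  rewrite -ltrBrDl (lt_le_trans (yz _ jk))//.
  by move: jk; rewrite -ltnS => jk; rewrite (bigmin_le _ (Ordinal jk)).
move=> x U /lambda0_nbhsP[k [e [e0 kU]]].
exists [set y : lambda0 | forall j, (j <= k)%N -> pnorm j (x - y) < e] => //.
split; first by exists x, k, e.
by move=> j _; rewrite subrr pnorm0.
Qed.
HB.instance Definition _ :=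
  PreTopologicalNmodule_isTopologicalNmodule.Build lambda0 lambda0_add_continuous.
HB.instance Definition _ :=
  TopologicalNmodule_isTopologicalLmodule.Build R[i] lambda0 lambda0_scale_continuous.
HB.instance Definition _ :=
  Uniform_isTvs.Build R[i] lambda0 lambda0_locally_convex.
Hypothesis halpha : increases_to_infty alpha.

Lemma weight_homo k m n : (m <= n)%N -> weight k n <= weight k m.
Proof.
move=> mn; rewrite ler_expR lerN2 ler_pM2r ?invr_gt0//.
have [_ incr _] := halpha; exact: (@homo_leq _ alpha <=%O lexx le_trans (fun i => ltW (incr i))).
Qed.

Lemma weight_cvg0 k : weight k n @[n --> \oo] --> 0.
Proof.
have [_ _ alpha_oo] := halpha.
apply: (@cvg_comp _ _ _ (fun n => alpha n / k.+1%:R) (fun x => expR (- x)));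
  last exact: cvgr_expR.
apply/cvgryPge => A; move/cvgryPge : alpha_oo => /(_ (A * k.+1%:R)).
by apply: filterS => n; rewrite ler_pdivlMr.
Qed.

Definition cesaro_seq (x : nat -> R[i]) : nat -> R[i] :=
  fun n => (\sum_(m < n.+1) x m) / n.+1%:R.

Lemma normc_sum n (f : 'I_n -> R[i]) : normc (\sum_i f i) <= \sum_i normc (f i).
Proof.
elim/big_ind2 : _ => //; first by rewrite normc0.
by move=> a b c d ab cd; rewrite (le_trans (le_normcD _ _))// lerD.
Qed.

Lemma weight_cesaro_le k (x : nat -> R[i]) n :
  weight k n * normc (cesaro_seq x n)
  <= n.+1%:R^-1 * \sum_(m < n.+1) weight k m * normc (x m).
Proof.
rewrite /cesaro_seq normcM normcV -[n.+1%:R]/(1 *+ n.+1) normcMn normc1.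
rewrite mulrA [leLHS]mulrC ler_wpM2l ?invr_ge0//.
rewrite (le_trans (ler_wpM2l (weight_ge0 k n) (normc_sum _)))// mulr_sumr.
apply: ler_sum => m _; rewrite ler_wpM2r ?normc_ge0//.
by apply: weight_homo; rewrite -ltnS.
Qed.

Lemma cesaro_mem (x : lambda0) : cesaro_seq x \in lambda0_pred.
Proof.
apply/lambda0P => k.
have /lambda0P/(_ k)/cesaro := lambda0_mem x.
apply: squeeze_cvgr; last exact: cvg_cst.
apply: nearW => n; rewrite mulr_ge0 ?weight_ge0 ?normc_ge0//=.
rewrite (le_trans (weight_cesaro_le _ _ _))// /arithmetic_mean /series/=.
by rewrite big_mkord.
Qed.

Definition cesaro_fun (x : lambda0) : lambda0 := Lambda0 (cesaro_mem x).

Lemma cesaro_fun_linear : linear cesaro_fun.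
Proof.
move=> a x y; apply/val_inj/funext => n.
have E : cesaro_seq (fun m => a * x m + y m) n
    = a * cesaro_seq x n + cesaro_seq y n.
  by rewrite /cesaro_seq big_split -mulr_sumr mulrDl mulrA.
exact: E.
Qed.

HB.instance Definition _ :=
  GRing.isLinear.Build R[i] lambda0 lambda0 _ cesaro_fun cesaro_fun_linear.

Lemma pnorm_cesaro_le k x : pnorm k (cesaro_fun x) <= pnorm k x.
Proof.
apply: pnorm_le => n; rewrite (le_trans (weight_cesaro_le _ _ _))//.
rewrite ler_pdivrMl// (le_trans (ler_sum _ (fun (m : 'I_n.+1) _ => le_pnorm k x m)))//.
by rewrite sumr_const card_ord mulr_natl.
Qed.

Lemma cesaro_fun_continuous : continuous cesaro_fun.
Proof.
move=> x U /lambda0_nbhsP[k [e [e0 kU]]]; apply/lambda0_nbhsP.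
exists k, e; split=> // y xy; apply: kU => j jk.
by rewrite -linearB (le_lt_trans (pnorm_cesaro_le _ _))// xy.
Qed.

(* The discrete Cesaro operator $\mathsf C \in \mathcal L(\Lambda_0(\alpha))$. *)
Definition cesaro_op : contLinear lambda0 := ContLinear cesaro_fun_continuous.

Lemma ones_mem : (fun=> 1) \in lambda0_pred.
Proof.
apply/lambda0P => k; under eq_fun do rewrite normc1 mulr1.
exact: weight_cvg0.
Qed.

Definition ones : lambda0 := Lambda0 ones_mem.

Lemma unit_vector_mem n : (fun m => (m == n)%:R) \in lambda0_pred.
Proof.
apply/lambda0P => k; apply: cvg_near_cst; exists n.+1 => // m /= nm.
by rewrite (gtn_eqF nm) normc0 mulr0.
Qed.

(* [unit_vector n] is $e_{n+1}$. *)
Definition unit_vector n : lambda0 := Lambda0 (unit_vector_mem n).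

End Lambda0.

(* Main.v *)
From HB Require Import structures.
Require Import Defs.
From mathcomp Require Import all_boot all_order all_algebra.
From mathcomp Require Import all_classical all_reals all_analysis.
From mathcomp Require Import complex.
From mathcomp Require Import ring.

(** Everything follows from one estimate on the invariant hyperplane of the
    sequences with vanishing first entry. Write [w k n] for the weights.

    Averaging such a sequence over its first [n.+1] entries involves at most [n]
    nonzero terms, so on the indices [n <= N] the Cesaro operator contracts the
    unweighted sup norm by the factor [N / (N + 1)] (lemma [cesaro_seq_head]).
    The indices [n > N] are controlled by the next seminorm: [w k] is the
    product of [w k.+1] and another weight, which tends to 0, and the Cesaro
    operator contracts every seminorm. Together ([pnorm_iter_cesaro]): the
    iterates of the Cesaro operator tend to 0 in every seminorm, at a rate that
    is uniform on bounded subsets of the hyperplane.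

    Since the constant sequence is fixed and the first entry is preserved, the
    iterates, and with them their means, converge uniformly on bounded sets to
    the projection sending [x] to the constant sequence with value [x 0]. Mean
    ergodicity, the kernel and the closed range are read off from this: a fixed
    point equals all its iterates, hence its projection; and if [x 0 = 0] then
    [x] is the limit of [x - C^m x], which lies in the range of [I - C]. Power
    boundedness is the contraction property of [C] in each seminorm, and the
    unit vectors span densely because a sequence in the space is the limit of
    its truncations. *)

Set Implicit Arguments.
Unset Strict Implicit.
Unset Printing Implicit Defensive.

Import Order.TTheory GRing.Theory Num.Theory.
Import numFieldNormedType.Exports.
Import Normc.

Local Open Scope classical_set_scope.
Local Open Scope ring_scope.

(** * Weights and the topology *)

Section Weights.
Variables (R : realType) (alpha : nat -> R).
Hypothesis halpha : increases_to_infty alpha.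

Let alpha_gt0 n : 0 < alpha n.
Proof. by have [a1 _ _] := halpha; rewrite (lt_trans ltr01). Qed.

Lemma weight_le1 k n : weight alpha k n <= 1.
Proof. by rewrite expR_le1 oppr_le0 divr_ge0// ltW. Qed.

Lemma weight_mono j k n : (j <= k)%N -> weight alpha j n <= weight alpha k n.
Proof.
move=> jk; rewrite ler_expR lerN2 ler_pM2l// lef_pV2 ?posrE//.
by rewrite ler_nat.
Qed.

(** [1/(k+1) = 1/((k+1)(k+2)) + 1/(k+2)]: passing to the next seminorm gains a
    factor that is itself one of the weights, hence tends to 0. *)
Lemma weight_factor k n :
  weight alpha k n = weight alpha (k.+1 * k.+2).-1 n * weight alpha k.+1 n.
Proof.
rewrite -expRD; congr expR; rewrite prednK// natrM.
rewrite -[k.+2%:R]natr1.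
have : k.+1%:R != 0 :> R by [].
have : k.+1%:R + 1 != 0 :> R by rewrite natr1.
by move: k.+1%:R => p p1 p0; field; rewrite p1 p0.
Qed.

Lemma pnorm_mono j k (x : lambda0 alpha) : (j <= k)%N -> pnorm j x <= pnorm k x.
Proof.
move=> jk; apply: pnorm_le => n; rewrite (le_trans _ (le_pnorm k x n))//.
by rewrite ler_wpM2r ?normc_ge0// weight_mono.
Qed.

(** The seminorms increase with their index, so balls for a single seminorm form
    a neighborhood basis. *)
Lemma nbhs_pnormP (x : lambda0 alpha) (A : set (lambda0 alpha)) :
  nbhs x A <->
  exists k (e : R), 0 < e /\ forall y : lambda0 alpha, pnorm k (x - y) < e -> A y.
Proof.
rewrite lambda0_nbhsP; split=> -[k [e [e0 kA]]]; exists k, e; split=> // y xy.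
  by apply: kA => j jk; rewrite (le_lt_trans (pnorm_mono _ jk)).
by apply: kA; exact: xy.
Qed.

Lemma closure_pnormP (A : set (lambda0 alpha)) (x : lambda0 alpha) :
  closure A x <-> forall k (e : R), 0 < e -> exists2 y, A y & pnorm k (x - y) < e.
Proof.
split=> [clA k e e0 | hA U /nbhs_pnormP[k [e [e0 kU]]]].
  have /clA[y [Ay xy]] : nbhs x [set y | pnorm k (x - y) < e].
    by apply/nbhs_pnormP; exists k, e.
  by exists y.
by have [y Ay xy] := hA k e e0; exists y; split=> //; exact: kU.
Qed.

Lemma pnorm_eq0 k (x : lambda0 alpha) : pnorm k x <= 0 -> x = 0.
Proof.
move=> x0; apply/val_inj/funext => n; apply: eq0_normc.
have := le_trans (le_pnorm k x n) x0.
by rewrite pmulr_rle0 ?weight_gt0// => xn; apply/eqP; rewrite eq_le xn normc_ge0.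
Qed.

Lemma tvs_bounded_pnorm (B : set (lambda0 alpha)) k :
  tvs_bounded B -> exists M, forall x, B x -> pnorm k x <= M.
Proof.
move=> /(_ [set y | pnorm k y < 1])[].
  apply/nbhs_pnormP; exists k, 1; split=> // y.
  by rewrite sub0r pnormN.
move=> r _ Br; exists (normc r) => x /Br[u /= u1 <-].
rewrite (le_trans (pnorm_scale_le _ _ _))// ler_piMr ?normc_ge0//.
exact: ltW.
Qed.

(** The first coordinate is continuous, being dominated by any of the seminorms;
    so its zero set contains the closure of each of its subsets. *)
Lemma closed_coord0 (A : set (lambda0 alpha)) :
  A `<=` [set x | x 0%N = 0] -> closure A `<=` [set x | x 0%N = 0].
Proof.
move=> A0 x /closure_pnormP clA; apply: eq0_normc; apply/eqP; apply/negPn/negP => xn0.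
have xgt0 : 0 < normc (x 0%N) by rewrite lt_neqAle eq_sym xn0 normc_ge0.
have [y /A0/= y0] := clA 0%N _ (mulr_gt0 (weight_gt0 alpha 0 0) xgt0).
move=> /(le_lt_trans (le_pnorm _ _ 0%N)).
have -> : (x - y) 0%N = x 0%N by rewrite -[RHS]subr0 -y0.
by rewrite ltxx.
Qed.

End Weights.

(** * The limit projection *)

Section Proj.
Variables (R : realType) (alpha : nat -> R).
Hypothesis halpha : increases_to_infty alpha.

(** The limit of the iterates: averaging preserves the first entry, so the only
    constant sequence that the iterates can approach is the one with value
    [x 0]. *)
Definition mean_proj (x : lambda0 alpha) : lambda0 alpha := x 0%N *: ones halpha.

Lemma mean_proj_linear : linear mean_proj.
Proof.
move=> a x y; rewrite /mean_proj scalerA -scalerDl; congr (_ *: _).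
Qed.

HB.instance Definition _ :=
  GRing.isLinear.Build R[i] (lambda0 alpha) (lambda0 alpha) _ mean_proj mean_proj_linear.

Lemma pnorm_mean_proj k x : pnorm k (mean_proj x) <= pnorm k x / weight alpha k 0.
Proof.
apply: pnorm_le => n; rewrite [mean_proj x n]mulr1.
rewrite ler_pdivlMr ?weight_gt0// -mulrA [normc _ * _]mulrC.
rewrite (le_trans _ (le_pnorm k x 0%N))// ler_piMl ?weight_le1//.
by rewrite mulr_ge0 ?weight_ge0 ?normc_ge0.
Qed.

Lemma mean_proj_continuous : continuous mean_proj.
Proof.
move=> x U /(nbhs_pnormP halpha)[k [e [e0 kU]]]; apply/(nbhs_pnormP halpha).
exists k, (e * weight alpha k 0); split; first by rewrite mulr_gt0 ?weight_gt0.
move=> y xy; apply: kU; rewrite -linearB (le_lt_trans (pnorm_mean_proj _ _))//.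
by rewrite ltr_pdivrMr ?weight_gt0.
Qed.

Definition mean_proj_op : contLinear (lambda0 alpha) := ContLinear mean_proj_continuous.

End Proj.

(** * Iterates and means of the Cesaro operator *)

Section Iterates.
Variables (R : realType) (alpha : nat -> R).
Hypothesis halpha : increases_to_infty alpha.
Notation C := (cesaro_fun halpha).

Lemma iter_cesaroB m x y : iter m C (x - y) = iter m C x - iter m C y.
Proof. by elim: m => //= m ->; rewrite linearB. Qed.

Lemma pnorm_iter_cesaro_le k m x : pnorm k (iter m C x) <= pnorm k x.
Proof. by elim: m => //= m; apply: le_trans; exact: pnorm_cesaro_le. Qed.

Lemma cesaro_coord0 x : C x 0%N = x 0%N.
Proof. by rewrite /= /cesaro_seq big_ord1 divr1. Qed.

Lemma iter_cesaro_coord0 m x : iter m C x 0%N = x 0%N.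
Proof. by elim: m => // m <-; exact: cesaro_coord0. Qed.

Lemma cesaro_ones : C (ones halpha) = ones halpha.
Proof.
apply/val_inj/funext => n; rewrite /= /cesaro_seq sumr_const card_ord.
by rewrite divff// pnatr_eq0.
Qed.

Lemma iter_cesaro_mean_proj m x : iter m C (mean_proj halpha x) = mean_proj halpha x.
Proof. by elim: m => //= m ->; rewrite /mean_proj linearZ/= cesaro_ones. Qed.

Lemma iter_cesaro_sub_proj m x :
  iter m C (x - mean_proj halpha x) = iter m C x - mean_proj halpha x.
Proof. by rewrite iter_cesaroB iter_cesaro_mean_proj. Qed.

Lemma sub_proj_coord0 x : (x - mean_proj halpha x) 0%N = 0.
Proof. by rewrite [LHS](_ : _ = x 0%N - x 0%N * 1)// mulr1 subrr. Qed.

(** The zero at index 0 leaves at most [n] nonzero terms in a sum that is divided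
    by [n + 1], and [n / (n + 1)] increases with [n]. *)
Lemma cesaro_seq_head (x : nat -> R[i]) N (K : R) : x 0%N = 0 ->
  (forall n, (n <= N)%N -> normc (x n) <= K) ->
  forall n, (n <= N)%N -> normc (cesaro_seq x n) <= N%:R / N.+1%:R * K.
Proof.
move=> x0 xK n nN.
have K0 : 0 <= K by rewrite (le_trans (normc_ge0 (x 0%N))) ?xK.
rewrite /cesaro_seq big_ord_recl x0 add0r normcM normcV.
rewrite -[n.+1%:R]/(1 *+ n.+1) normcMn normc1.
rewrite ler_pdivrMr//.
rewrite (le_trans (normc_sum _))// (@le_trans _ _ (n%:R * K))//.
  rewrite -[X in _ <= X%:R * _]card_ord mulr_natl -sumr_const; apply: ler_sum => i _.
  by apply: xK; rewrite /= /bump /= add1n (leq_trans (ltn_ord i)).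
rewrite mulrAC ler_wpM2r// mulrAC ler_pdivlMr//.
by rewrite -!natrM ler_nat !mulnS mulnC leq_add2r.
Qed.

Lemma iter_cesaro_head (x : lambda0 alpha) N (K : R) m : x 0%N = 0 ->
  (forall n, (n <= N)%N -> normc (x n) <= K) ->
  forall n, (n <= N)%N -> normc (iter m C x n) <= (N%:R / N.+1%:R) ^+ m * K.
Proof.
move=> x0 xK; elim: m => [|m IH] n nN; first by rewrite mul1r xK.
rewrite exprS -mulrA; apply: cesaro_seq_head nN => //.
by rewrite iter_cesaro_coord0.
Qed.

(** The central estimate: [r] and [H] depend on [x] only through the bound [M]
    for the next seminorm, so the convergence to 0 is uniform on bounded sets. *)
Lemma pnorm_iter_cesaro k (M e : R) : 0 < e ->
  exists r H, [/\ 0 <= r, r < 1 & forall x : lambda0 alpha,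
    x 0%N = 0 -> pnorm k.+1 x <= M ->
    forall m, pnorm k (iter m C x) <= r ^+ m * H + e].
Proof.
move=> e0; pose M1 := `|M| + 1.
have M10 : 0 < M1 by rewrite ltr_wpDl.
(* Beyond [N] the ratio of the two weights beats the bound on the next seminorm. *)
have [N _ hN] : \forall n \near \oo, weight alpha (k.+1 * k.+2).-1 n <= e / M1.
  by apply: (cvgr_le _ (weight_cvg0 halpha _)); rewrite divr_gt0.
(* [H] bounds the entries up to [N], the weight being smallest at [N]. *)
exists (N%:R / N.+1%:R), (M1 / weight alpha k.+1 N); split.
- by rewrite divr_ge0.
- by rewrite ltr_pdivrMr// mul1r ltr_nat.
move=> x x0 xM m; set r := _ / N.+1%:R.
have xM1 : pnorm k.+1 x <= M1.
  by rewrite (le_trans xM)// (le_trans (ler_norm _))// lerDl.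
have rH0 : 0 <= r ^+ m * (M1 / weight alpha k.+1 N).
  by rewrite mulr_ge0 ?exprn_ge0// divr_ge0 ?weight_ge0// ltW.
apply: pnorm_le => n; have [nN|/ltnW nN] := leqP n N.
  rewrite (@le_trans _ _ (normc (iter m C x n)))//.
    by rewrite ler_piMl ?normc_ge0 ?weight_le1.
  rewrite ler_wpDr ?(ltW e0)//; apply: iter_cesaro_head nN => // i iN.
  rewrite ler_pdivlMr ?weight_gt0// mulrC.
  rewrite (le_trans _ xM1)// (le_trans _ (le_pnorm k.+1 x i))//.
  by rewrite ler_wpM2r ?normc_ge0 ?weight_homo.
rewrite ler_wpDl// weight_factor -mulrA.
rewrite (@le_trans _ _ (e / M1 * M1))//; last by rewrite divfK// gt_eqF.
rewrite ler_pM ?mulr_ge0 ?weight_ge0 ?normc_ge0 ?hN//.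
by rewrite (le_trans (le_pnorm _ _ _))// (le_trans (pnorm_iter_cesaro_le _ _ _)).
Qed.

Lemma iter_cesaro_small k (e : R) (x : lambda0 alpha) : 0 < e -> x 0%N = 0 ->
  exists m, pnorm k (iter m C x) < e.
Proof.
move=> e0 x0.
have e20 : 0 < e / 2 by rewrite divr_gt0.
have [r [H [r0 r1 rH]]] := pnorm_iter_cesaro k (pnorm k.+1 x) e20.
have : r ^+ m * H @[m --> \oo] --> 0.
  by rewrite -(mul0r H); apply: cvgMl; apply: cvg_expr; rewrite ger0_norm.
move=> /cvgr_lt/(_ _ e20)[m _ /(_ m (leqnn m)) mH].
exists m; rewrite (le_lt_trans (rH x x0 _ m))// [ltRHS]splitr ltrD2r.
exact: mH.
Qed.

(** Removing the projection turns a fixed point into a fixed point with vanishing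
    first entry, whose iterates can tend to 0 only if it is 0. *)
Lemma cesaro_fixed_proj x : C x = x -> x = mean_proj halpha x.
Proof.
move=> Cx; apply/eqP; rewrite -subr_eq0; apply/eqP/(@pnorm_eq0 _ _ 0).
rewrite leNgt; apply/negP => e0.
have [m] := iter_cesaro_small 0 e0 (sub_proj_coord0 x).
have -> : iter m C (x - mean_proj halpha x) = x - mean_proj halpha x.
  by rewrite iter_cesaro_sub_proj; congr (_ - _); elim: m => //= m ->.
by rewrite ltxx.
Qed.

(** The telescoping factorization [I - C^m = (I - C)(I + C + ... + C^(m-1))]. *)
Lemma sub_iter_cesaro m x : exists y, x - iter m C x = y - C y.
Proof.
exists (\sum_(i < m) iter i C x); elim: m => [|m IH].
  by rewrite big_ord0 linear0 !subrr.
rewrite big_ord_recr linearD/= opprD addrACA -IH.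
by rewrite addrA subrK.
Qed.

(** If [x 0 = 0], then [x - C^m x] lies in the range of [I - C] and tends to
    [x]. *)
Lemma closure_image_sub_cesaro :
  closure [set x - C x | x in [set: lambda0 alpha]] = [set x | x 0%N = 0].
Proof.
apply/seteqP; split.
  apply: (closed_coord0 halpha) => _ [x _ <-] /=.
  by rewrite [LHS](_ : _ = x 0%N - C x 0%N)// cesaro_coord0 subrr.
move=> x x0; apply/(closure_pnormP halpha) => k e e0.
have [m xm] := iter_cesaro_small k e0 x0.
exists (x - iter m C x); last by rewrite subKr.
by have [y ->] := sub_iter_cesaro m x; exists y.
Qed.

Lemma cesaro_mean_sub_proj n x : (0 < n)%N ->
  mean_proj halpha x - cesaro_mean C n x =
  - (n%:R^-1 *: \sum_(1 <= m < n.+1) iter m C (x - mean_proj halpha x)).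
Proof.
move=> n0; under [in RHS]eq_bigr do rewrite iter_cesaro_sub_proj.
rewrite sumrB scalerBr opprB; congr (_ - _).
rewrite sumr_const_nat subn1/= -(scaler_nat n (mean_proj halpha x)) scalerA mulVf ?scale1r//.
by rewrite pnatr_eq0 -lt0n.
Qed.

Lemma pnorm_sum k m n (f : nat -> lambda0 alpha) :
  pnorm k (\sum_(m <= i < n) f i) <= \sum_(m <= i < n) pnorm k (f i).
Proof.
elim/big_ind2 : _ => //; first by rewrite pnorm0.
by move=> a b c d ab cd; rewrite (le_trans (pnorm_triangle _ _ _))// lerD.
Qed.

(** The seminorm of the [n]-th mean is at most the mean of the bounds
    [r ^+ m * H + e / 2] for [m = 1, ..., n], which tends to [e / 2] because
    arithmetic means inherit limits. *)
Lemma cesaro_mean_cvg_bounded (B : set (lambda0 alpha)) k (e : R) :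
  tvs_bounded B -> 0 < e ->
  \forall n \near \oo, forall x, B x ->
    pnorm k (mean_proj halpha x - cesaro_mean C n x) < e.
Proof.
move=> /(tvs_bounded_pnorm halpha k.+1)[M BM] e0.
have e20 : 0 < e / 2 by rewrite divr_gt0.
have [r [H [r0 r1 rH]]] :=
  pnorm_iter_cesaro k (M + M / weight alpha k.+1 0) e20.
pose u m := r ^+ m.+1 * H + e / 2.
have : u m @[m --> \oo] --> e / 2.
  rewrite -[X in _ --> X]add0r -(mul0r H); apply: cvgD; last exact: cvg_cst.
  apply: cvgMl; rewrite (@cvg_shiftS _ (fun m => r ^+ m)).
  by apply: cvg_expr; rewrite ger0_norm.
move=> /cesaro/cvgr_lt/(_ e)[|N _ hN]; first by rewrite [ltRHS]splitr ltrDl.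
(* [arithmetic_mean u n] averages [u 0, ..., u n]: this is the mean of order
   [n.+1]. *)
exists N.+1 => // -[//|n] /hN hn x Bx; apply: le_lt_trans hn.
rewrite cesaro_mean_sub_proj// pnormN (le_trans (pnorm_scale_le _ _ _))//.
rewrite normcV -[n.+1%:R]/(1 *+ n.+1) normcMn normc1.
rewrite ler_wpM2l ?invr_ge0// (le_trans (pnorm_sum _ _ _ _))//.
rewrite big_add1; apply: ler_sum => m _; apply: rH; first exact: sub_proj_coord0.
rewrite (le_trans (pnorm_triangle _ _ _))// pnormN lerD ?BM//.
rewrite (le_trans (pnorm_mean_proj _ _ _))//.
by rewrite ler_wpM2r ?invr_ge0 ?weight_ge0 ?BM.
Qed.

Lemma cesaro_power_bounded : power_bounded C.
Proof.
move=> x E [k [e [e0 kE]]]; apply/(nbhs_pnormP halpha).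
exists k, e; split=> // y xy n _; apply: kE => j jk.
rewrite -iter_cesaroB (le_lt_trans (pnorm_iter_cesaro_le _ _ _))//.
by rewrite (le_lt_trans (pnorm_mono halpha _ jk)).
Qed.

Lemma cesaro_uniformly_mean_ergodic : uniformly_mean_ergodic (cesaro_op halpha).
Proof.
exists (mean_proj_op halpha); apply/fam_cvgP => B bB U /uniform_nbhs[E [[k [e [e0 kE]]] EU]].
apply: filterS (cesaro_mean_cvg_bounded k bB e0) => n nB; apply: EU => x Bx.
by apply: kE => j jk; rewrite (le_lt_trans (pnorm_mono halpha _ jk))// nB.
Qed.

Lemma ker_sub_cesaro :
  [set x | x - C x = 0] = linear_span [set ones halpha].
Proof.
apply/seteqP; split=> [x /= /subr0_eq /esym/cesaro_fixed_proj xE|].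
  exists 1%N, (fun=> ones halpha), (fun=> x 0%N); split=> //.
  by rewrite big_ord1.
move=> _ [n [v [c [v1 ->]]]] /=.
rewrite linear_sum/= -sumrB big1// => i _.
by rewrite linearZ/= v1 cesaro_ones subrr.
Qed.

Lemma closure_span_unit_vectors :
  closure (linear_span [set unit_vector alpha n | n in [set n | (1 <= n)%N]]) =
  [set x | x 0%N = 0].
Proof.
have sumE N (v : 'I_N -> lambda0 alpha) (c : 'I_N -> R[i]) n :
    (\sum_i c i *: v i) n = \sum_i c i * v i n.
  elim/big_rec2 : _ => // i y1 y2 _ <-.
  exact: (erefl : (c i *: v i + y2) n = c i * v i n + y2 n).
apply/seteqP; split.
  apply: (closed_coord0 halpha) => _ [N [v [c [v1 ->]]]] /=; rewrite sumE big1// => i _.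
  by have [[//|n] _ <-] := v1 i; rewrite /= mulr0.
move=> x x0; apply/(closure_pnormP halpha) => k e e0.
have /lambda0P/(_ k)/cvgr_le/(_ (e / 2)) := lambda0_mem x.
case=> [|N _ hN]; first by rewrite divr_gt0.
(* The truncation of [x] at index [N]; the term of index 0 vanishes. *)
exists (\sum_(i < N) x i.+1 *: unit_vector alpha i.+1).
  exists N, (fun i => unit_vector alpha i.+1), (fun i => x i.+1); split=> // i.
  by exists i.+1.
rewrite (@le_lt_trans _ _ (e / 2))//; last by rewrite [ltRHS]splitr ltrDl divr_gt0.
apply: pnorm_le => n.
set y := \sum_(i < N) _.
have -> : (x - y) n = x n - y n by [].
rewrite /y sumE /=; case: n => [|n].
  by rewrite x0 big1 ?subr0 ?normc0 ?mulr0 ?divr_ge0 ?ltW// => i _; rewrite mulr0.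
have [nN|nN] := ltnP n N.
  rewrite (bigD1 (Ordinal nN))//= eqxx mulr1 big1 ?addr0 ?subrr ?normc0 ?mulr0//.
    by rewrite divr_ge0 ?ltW.
  move=> i; rewrite -val_eqE/= eqSS eq_sym => /negPf ->.
  by rewrite mulr0.
rewrite big1 ?subr0; first by apply: hN; rewrite /= ltnW.
move=> i _; rewrite eqSS gtn_eqF ?mulr0//.
by rewrite (leq_trans _ nN).
Qed.

End Iterates.

Theorem proposition3p1 (R : realType) (alpha : nat -> R)
    (halpha : increases_to_infty alpha) :
  let C : contLinear (lambda0 alpha) := cesaro_op halpha in
  let ker_IC := [set x : lambda0 alpha | x - C x = 0] in
  let im_IC := [set x - C x | x in [set: lambda0 alpha]] in
  [/\ power_bounded C,
      uniformly_mean_ergodic C,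
      direct_sum ker_IC (closure im_IC),
      ker_IC = linear_span [set ones halpha] &
      closure im_IC = [set x : lambda0 alpha | x 0%N = 0] /\
      [set x : lambda0 alpha | x 0%N = 0] =
        closure (linear_span
          [set unit_vector alpha n | n in [set n | (1 <= n)%N]])].
Proof.
move=> C ker_IC im_IC.
have imE : closure im_IC = [set x | x 0%N = 0] by exact: closure_image_sub_cesaro.
split.
- exact: cesaro_power_bounded.
- exact: cesaro_uniformly_mean_ergodic.
- rewrite imE; split=> [x|].
    exists (mean_proj halpha x), (x - mean_proj halpha x); split.
    + by apply/eqP; rewrite subr_eq0; apply/eqP/esym/(iter_cesaro_mean_proj halpha 1).
    + exact: sub_proj_coord0.
    + by rewrite addrC subrK.
  apply/seteqP; split=> [x [/subr0_eq/esym/cesaro_fixed_proj xE x0]|_ ->] /=.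
    by rewrite xE /mean_proj x0 scale0r.
  by split=> //; rewrite /ker_IC /= linear0 subrr.
- exact: ker_sub_cesaro.
- by split; rewrite ?closure_span_unit_vectors.
Qed.
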